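(* Let $L$ be a finite-dimensional Lie algebra over a field of characteristic $0$. Each element of the ascending central series of $L$ is invariant with respect to any Lie-orthogonal operator on $L$.
   Context: A linear operator $J$ on a Lie algebra $L$ is called Lie-orthogonal if $[Jx,Jy]=[x,y]$ for all $x,y\in L$. The ascending central series of $L$ is the sequence of ideals $Z_0=\{0\}\subseteq Z_1\subseteq Z_2\subseteq\cdots$, where $Z_{i+1}$ is the preimage in $L$ of the center of $L/Z_i$. A subspace $V$ is invariant with respect to $J$ if $J(V)\subseteq V$. *)

(* Defs.v *)
(* MathComp *)
From HB Require Import structures.
From mathcomp Require Import all_boot all_order all_algebra.

Set Implicit Arguments.
Unset Strict Implicit.
Unset Printing Implicit Defensive.

Import GRing.Theory.
Local Open Scope ring_scope.
Local Open Scope quotient_scope.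

Reserved Notation "[lie x , y ]" (format "[lie  x ,  y ]").

(* Finite-dimensional Lie algebras: being a vectType is part of the structure. *)
HB.mixin Record Vector_isLie (F : fieldType) (L : Type) of Vector F L := {
  lie_bracket : L -> L -> L;
  lie_bracket_bilinear :
    bilinear_for *:%R *:%R lie_bracket;
  lie_alternating : forall x, lie_bracket x x = 0;
  lie_jacobi : forall x y z,
    lie_bracket x (lie_bracket y z) + lie_bracket y (lie_bracket z x)
      + lie_bracket z (lie_bracket x y) = 0
}.

#[short(type="lieAlgType")]
HB.structure Definition LieAlgebra (F : fieldType) :=
  {L of Vector_isLie F L & Vector F L}.

Notation "[lie x , y ]" := (lie_bracket x y) : ring_scope.

HB.instance Definition _ (F : fieldType) (L : lieAlgType F) :=
  bilinear_isBilinear.Build F L L L _ _ (@lie_bracket F L)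
    (@lie_bracket_bilinear F L).

Section LieTheory.
Variables (F : fieldType) (L : lieAlgType F).
Implicit Types x y z : L.

Lemma lieC x y : [lie x, y] = - [lie y, x].
Proof.
apply/eqP; rewrite -addr_eq0; apply/eqP.
have := lie_alternating (x + y).
by rewrite linearDl !linearDr /= !lie_alternating add0r addr0.
Qed.

Lemma lie0r x : [lie x, 0] = 0. Proof. exact: linear0r. Qed.

Lemma lie0l x : [lie 0, x] = 0. Proof. exact: linear0l. Qed.

Fact lie_bracket_linearr x : linear (lie_bracket x).
Proof. exact: (@lie_bracket_bilinear F L).2. Qed.

HB.instance Definition _ x :=
  GRing.isLinear.Build F L L _ (lie_bracket x) (lie_bracket_linearr x).

(* A left ideal of a Lie algebra is two-sided, by [lieC]. *)
Record lie_ideal := LieIdeal {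
  lie_ideal_space :> {vspace L};
  lie_idealP : forall x y, y \in lie_ideal_space -> [lie x, y] \in lie_ideal_space
}.

Lemma lie_ideall (I : lie_ideal) x y : x \in I -> [lie x, y] \in I.
Proof. by move=> xI; rewrite lieC rpredN lie_idealP. Qed.

Fact lie_ideal0_subproof x y : y \in 0%VS -> [lie x, y] \in (0%VS : {vspace L}).
Proof. by rewrite !memv0 => /eqP ->; rewrite lie0r. Qed.

Definition lie_ideal0 : lie_ideal := LieIdeal lie_ideal0_subproof.

Definition lie_ad x : 'End(L) := linfun (lie_bracket x).

Lemma lie_adE x y : lie_ad x y = [lie x, y].
Proof. exact: lfunE. Qed.

Fact lie_ad_linear : linear lie_ad.
Proof.
move=> a x y; apply/lfunP => z.
by rewrite add_lfunE scale_lfunE !lie_adE linearDl linearZl_LR.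
Qed.

HB.instance Definition _ :=
  GRing.isLinear.Build F L 'End(L) _ lie_ad lie_ad_linear.

(* The center is the kernel of the adjoint map; see [mem_lie_center]. *)
Definition lie_center_space : {vspace L} := lker (linfun lie_ad).

Lemma mem_lie_center x :
  reflect (forall y, [lie x, y] = 0) (x \in lie_center_space).
Proof.
rewrite memv_ker lfunE /=; apply: (iffP eqP) => [adx0 y | adx0].
  by rewrite -lie_adE adx0 lfunE.
by apply/lfunP => y; rewrite lie_adE zero_lfunE adx0.
Qed.

Fact lie_center_subproof x y :
  y \in lie_center_space -> [lie x, y] \in lie_center_space.
Proof.
by move/mem_lie_center => cy; rewrite lieC cy oppr0 rpred0.
Qed.

Definition lie_center : lie_ideal := LieIdeal lie_center_subproof.

End LieTheory.

Section LieQuotient.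
Variables (F : fieldType) (L : lieAlgType F) (I : lie_ideal L).
Local Notation U := (lie_ideal_space I).

Definition lie_quot := Quotient.quot (pred_of_vspace U).
HB.instance Definition _ := GRing.Zmodule.on lie_quot.
HB.instance Definition _ := EqQuotient.on lie_quot.
HB.instance Definition _ := ZmodQuotient.on lie_quot.

Lemma lie_quot_eqP (x y : L) :
  reflect (\pi_lie_quot x = \pi_lie_quot y) (x - y \in U).
Proof. by rewrite [_ \in U]Quotient.idealrBE; apply: eqP. Qed.

Lemma lie_quot_surj (q : lie_quot) : exists x, q = \pi_lie_quot x.
Proof. by exists (repr q); rewrite reprK. Qed.

Lemma lie_quot_reprK (x : L) : repr (\pi_lie_quot x) - x \in U.
Proof. by apply/lie_quot_eqP; rewrite reprK. Qed.

Lemma lie_quot_piD (x y : L) :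
  \pi_lie_quot (x + y) = \pi_lie_quot x + \pi_lie_quot y.
Proof. exact: (raddfD (\pi_lie_quot)). Qed.

Definition lie_quot_scale (a : F) (q : lie_quot) : lie_quot :=
  \pi_lie_quot (a *: repr q).

Lemma lie_quot_scaleE a (x : L) :
  lie_quot_scale a (\pi_lie_quot x) = \pi_lie_quot (a *: x).
Proof. by apply/lie_quot_eqP; rewrite -scalerBr rpredZ // lie_quot_reprK. Qed.

Fact lie_quot_scaleA a b q :
  lie_quot_scale a (lie_quot_scale b q) = lie_quot_scale (a * b) q.
Proof. by have [x ->] := lie_quot_surj q; rewrite !lie_quot_scaleE scalerA. Qed.

Fact lie_quot_scale1 : left_id 1 lie_quot_scale.
Proof. by move=> q; have [x ->] := lie_quot_surj q; rewrite lie_quot_scaleE scale1r. Qed.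

Fact lie_quot_scaleDr : right_distributive lie_quot_scale +%R.
Proof.
move=> a p q; have [x ->] := lie_quot_surj p; have [y ->] := lie_quot_surj q.
by rewrite -lie_quot_piD !lie_quot_scaleE scalerDr lie_quot_piD.
Qed.

Fact lie_quot_scaleDl q : {morph lie_quot_scale^~ q : a b / a + b}.
Proof.
move=> a b; have [x ->] := lie_quot_surj q.
by rewrite !lie_quot_scaleE scalerDl lie_quot_piD.
Qed.

HB.instance Definition _ := GRing.Zmodule_isLmodule.Build F lie_quot
  lie_quot_scaleA lie_quot_scale1 lie_quot_scaleDr lie_quot_scaleDl.

Lemma lie_quot_pi_linear : linear (\pi_lie_quot : L -> lie_quot).
Proof.
move=> a x y; rewrite lie_quot_piD; congr (_ + _).
by rewrite -lie_quot_scaleE.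
Qed.

HB.instance Definition _ :=
  GRing.isLinear.Build F L lie_quot _ (\pi_lie_quot) lie_quot_pi_linear.

Local Notation W := (U^C)%VS.

Let comp_proj : 'End(L) := daddv_pi W U.

Fact comp_proj_pi (x y : L) :
  \pi_lie_quot x = \pi_lie_quot y -> comp_proj x = comp_proj y.
Proof.
move/lie_quot_eqP => xyU; apply/eqP; rewrite -subr_eq0 -linearB /=.
have WU : (W :&: U = 0)%VS by rewrite capvC capv_compl.
have UW : (U :&: W = 0)%VS by rewrite capv_compl.
have xy_sum : x - y \in (W + U)%VS by rewrite addvC addv_complf memvf.
have := daddv_pi_add WU xy_sum.
by rewrite (daddv_pi_id UW xyU) -[RHS]add0r => /addIr ->.
Qed.

Fact comp_proj_pi_id (x : L) : \pi_lie_quot (comp_proj x) = \pi_lie_quot x.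
Proof.
have WU : (W :&: U = 0)%VS by rewrite capvC capv_compl.
have x_sum : x \in (W + U)%VS by rewrite addvC addv_complf memvf.
apply/lie_quot_eqP; rewrite -{2}(daddv_pi_add WU x_sum) opprD addNKr.
by rewrite rpredN memv_pi.
Qed.

(* L / I is linearly isomorphic to a complement of I in L. *)
Fact lie_quot_vect_iso : Vector.axiom (\dim W) lie_quot.
Proof.
have [g g_lin g_bij] := subvs_vect_iso W.
pose f (q : lie_quot) := g (vsproj W (comp_proj (repr q))).
have fE x : f (\pi x) = g (vsproj W (comp_proj x)).
  by rewrite /f (@comp_proj_pi _ x) ?reprK.
exists f => [a p q|].
  have [x ->] := lie_quot_surj p; have [y ->] := lie_quot_surj q.
  rewrite -lie_quot_pi_linear !fE -g_lin; congr g.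
  by rewrite (linearP comp_proj) /= (linearP (vsproj W)).
have [h gK hK] := g_bij.
exists (fun r => \pi_lie_quot (vsval (h r))) => [q|r].
  have [x ->] := lie_quot_surj q.
  by rewrite fE gK vsprojK ?memv_pi // comp_proj_pi_id.
rewrite fE /comp_proj daddv_pi_id ?subvsP ?vsvalK ?hK //.
by rewrite capvC capv_compl.
Qed.

HB.instance Definition _ :=
  Lmodule_hasFinDim.Build F lie_quot lie_quot_vect_iso.

Definition lie_quot_bracket (p q : lie_quot) : lie_quot :=
  \pi_lie_quot [lie repr p, repr q].

Lemma lie_quot_bracketE (x y : L) :
  lie_quot_bracket (\pi_lie_quot x) (\pi_lie_quot y) = \pi_lie_quot [lie x, y].
Proof.
apply/lie_quot_eqP.
set x' := repr _; set y' := repr _.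
have -> : [lie x', y'] - [lie x, y] = [lie x' - x, y'] + [lie x, y' - y].
  by rewrite linearBl linearBr /= addrA subrK.
by apply: rpredD; [apply: lie_ideall|apply: lie_idealP]; apply: lie_quot_reprK.
Qed.

Fact lie_quot_bilinear : bilinear_for *:%R *:%R lie_quot_bracket.
Proof.
split=> [r a p q|p a q r];
  have [x ->] := lie_quot_surj p; have [y ->] := lie_quot_surj q;
  have [z ->] := lie_quot_surj r; rewrite -lie_quot_pi_linear !lie_quot_bracketE.
  by rewrite linearDl linearZl_LR lie_quot_pi_linear.
by rewrite linearDr linearZr_LR linearP.
Qed.

Fact lie_quot_alternating p : lie_quot_bracket p p = 0.
Proof.
by have [x ->] := lie_quot_surj p; rewrite lie_quot_bracketE lie_alternating linear0.
Qed.

Fact lie_quot_jacobi p q r :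
  lie_quot_bracket p (lie_quot_bracket q r)
    + lie_quot_bracket q (lie_quot_bracket r p)
    + lie_quot_bracket r (lie_quot_bracket p q) = 0.
Proof.
have [x ->] := lie_quot_surj p; have [y ->] := lie_quot_surj q; have [z ->] := lie_quot_surj r.
by rewrite !lie_quot_bracketE -!lie_quot_piD lie_jacobi linear0.
Qed.

HB.instance Definition _ := Vector_isLie.Build F lie_quot
  lie_quot_bilinear lie_quot_alternating lie_quot_jacobi.

Definition lie_quot_pi : 'Hom(L, lie_quot) := linfun (\pi_lie_quot).

Lemma lie_quot_piM (x y : L) :
  lie_quot_pi [lie x, y] = [lie lie_quot_pi x, lie_quot_pi y].
Proof. by rewrite !lfunE /= -lie_quot_bracketE. Qed.

Section Preimage.
Variable K : lie_ideal lie_quot.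

Fact lie_quot_preim_subproof x y :
  y \in (lie_quot_pi @^-1: K)%VS -> [lie x, y] \in (lie_quot_pi @^-1: K)%VS.
Proof. by rewrite -!memv_preim lie_quot_piM; apply: lie_idealP. Qed.

Definition lie_quot_preim : lie_ideal L := LieIdeal lie_quot_preim_subproof.

End Preimage.

End LieQuotient.

Fixpoint lie_ascending_central (F : fieldType) (L : lieAlgType F) (i : nat) :
    lie_ideal L :=
  if i is i'.+1 then
    let Z := lie_ascending_central L i' in
    lie_quot_preim (lie_center (lie_quot Z))
  else lie_ideal0 L.

Definition lie_orthogonal (F : fieldType) (L : lieAlgType F) (J : 'End(L)) :=
  forall x y : L, [lie J x, J y] = [lie x, y].

(* Main.v *)
(* An orthogonal [J] satisfies [J^-1(Z_(i+1)) <= Z_(i+1)]: if [J x] lies in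
   [Z_(i+1)], then [[x, y] = [J x, J y]] lies in [Z_i] for every [y].  A preimage
   under an endomorphism of a finite-dimensional space has at least the dimension
   of the subspace, so [J^-1(Z_(i+1)) = Z_(i+1)]. *)
Require Import Defs.
From mathcomp Require Import all_boot all_order all_algebra.

Set Implicit Arguments.
Unset Strict Implicit.
Unset Printing Implicit Defensive.

Import GRing.Theory.
Local Open Scope ring_scope.

(** Rank-nullity on the preimage gives it dimension [\dim (lker f) + \dim (U :&: limg f)]; the bound
    follows from [U + limg f] fitting inside [V]. *)
Lemma dimv_lpreim_ge (F : fieldType) (V : vectType F) (f : 'End(V))
    (U : {vspace V}) : (\dim U <= \dim (f @^-1: U))%N.
Proof.
have imP : (f @: (f @^-1: U) = U :&: limg f)%VS.
  by rewrite -lpreim_cap_limg lpreimK // capvSr.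
have kerP : (f @^-1: U :&: lker f = lker f)%VS.
  by apply/capv_idPr; rewrite -lpreim0 lpreimS ?sub0v.
have dimP := limg_ker_dim f (f @^-1: U); rewrite imP kerP in dimP.
have dimV := limg_ker_dim f fullv; rewrite capfv in dimV.
have dimS : (\dim (U + limg f) <= \dim {:V})%N by rewrite dimvS ?subvf.
rewrite -dimP -(leq_add2r (\dim (limg f))) -dimv_sum_cap.
by rewrite addnAC dimV leq_add2r.
Qed.

Lemma limg_sub_of_lpreim_sub (F : fieldType) (V : vectType F) (f : 'End(V))
    (U : {vspace V}) : (f @^-1: U <= U)%VS -> (f @: U <= U)%VS.
Proof.
move=> sPU; have eqPU : (f @^-1: U = U)%VS.
  by apply/eqP; rewrite eqEdim sPU dimv_lpreim_ge.
by apply/subvP => _ /memv_imgP[x xU ->]; rewrite memv_preim eqPU.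
Qed.

(** Eliminates the quotient, so that orthogonality can be applied to brackets in [L] itself. *)
Lemma mem_lie_ascending_centralS (F : fieldType) (L : lieAlgType F) i (x : L) :
  x \in lie_ascending_central L i.+1 <->
  (forall y, [lie x, y] \in lie_ascending_central L i).
Proof.
set Z := lie_ascending_central L i.
have piE y : ([lie x, y] \in Z) = ([lie lie_quot_pi Z x, lie_quot_pi Z y] == 0).
  rewrite -lie_quot_piM lfunE /= -(linear0 (\pi%qT : L -> lie_quot Z)).
  by apply/idP/eqP => [?|/lie_quot_eqP]; [apply/lie_quot_eqP|]; rewrite subr0.
rewrite /= -memv_preim; split=> [/mem_lie_center cx y | cx].
  by rewrite piE cx.
apply/mem_lie_center => q; have [y ->] := lie_quot_surj q.
by apply/eqP; have := cx y; rewrite piE (lfunE _ y).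
Qed.

Theorem proposition8 (F : fieldType) (charF0 : [pchar F] =i pred0)
    (L : lieAlgType F) (J : 'End(L)) (orthJ : lie_orthogonal J) (i : nat) :
  (J @: lie_ascending_central L i <= lie_ascending_central L i)%VS.
Proof.
(* The preimage argument needs a successor index: for [Z_0 = 0] it would require [J] to be
   injective. *)
case: i => [|i]; first by rewrite limg0 subvv.
apply: limg_sub_of_lpreim_sub; apply/subvP => x.
rewrite -memv_preim => /mem_lie_ascending_centralS cJx.
(* [cJx] is used only at elements of the form [J y]. *)
by apply/mem_lie_ascending_centralS => y; rewrite -orthJ.
Qed.
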